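(* Let $G$ be a chordal$^*$ graph on $n$ vertices and let $G^c$ be the complementary graph of $G$. Then $$\kappa(G) + \tau_{\max}(G^c) \le n-1$$ and $$0 \leq \kappa(G) \leq (n - 1) - \lceil 2\sqrt{n}-2\,\rceil.$$ Furthermore, for every integer $\kappa$ with $0 \leq \kappa \leq (n - 1) - \lceil 2\sqrt{n}-2\,\rceil$, there exists a chordal$^*$ graph $G$ on $n$ vertices satisfying $\kappa(G) = \kappa$.
   Context: All graphs are finite and simple (no loops, no multiple edges). A graph is chordal if every cycle of length at least $4$ has a chord. A vertex $x$ of $G$ is universal if $x$ is adjacent to every other vertex of $G$. A chordal$^*$ graph is a chordal graph with no universal vertex. The complementary graph $G^c$ has the same vertex set as $G$, with $\{x,y\}$ ($x\neq y$) an edge of $G^c$ iff it is not an edge of $G$. The vertex connectivity $\kappa(G)$ is the minimum cardinality of a subset $W \subset V(G)$ such that the induced subgraph of $G$ on $V(G)\setminus W$ is disconnected (so $\kappa(G)=0$ if $G$ is disconnected). A vertex cover of a graph $H$ is a subset $C\subset V(H)$ meeting every edge of $H$; $\tau_{\max}(H)$ denotes the maximum cardinality of a minimal (with respect to inclusion) vertex cover of $H$. *)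

(* Defs.v *)
From mathcomp Require Import all_boot.
Set Implicit Arguments.
Unset Strict Implicit.
Unset Printing Implicit Defensive.

Record sgraph := SGraph {
  vertex :> finType;
  adj : rel vertex;
  adj_sym : symmetric adj;
  adj_irrefl : irreflexive adj
}.

Section Complement.
Variable G : sgraph.

Definition compl_adj : rel G := [rel x y | (x != y) && ~~ adj x y].

Lemma compl_adj_sym : symmetric compl_adj.
Proof. by move=> x y; rewrite /compl_adj /= eq_sym adj_sym. Qed.

Lemma compl_adj_irrefl : irreflexive compl_adj.
Proof. by move=> x; rewrite /compl_adj /= eqxx. Qed.

Definition complement : sgraph := SGraph compl_adj_sym compl_adj_irrefl.

End Complement.

Section Induced.
Variables (G : sgraph) (S : {set G}).

Definition induced_adj : rel {x : G | x \in S} :=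
  [rel x y | adj (val x) (val y)].

Lemma induced_adj_sym : symmetric induced_adj.
Proof. by move=> x y; rewrite /induced_adj /= adj_sym. Qed.

Lemma induced_adj_irrefl : irreflexive induced_adj.
Proof. by move=> x; rewrite /induced_adj /= adj_irrefl. Qed.

Definition induced : sgraph := SGraph induced_adj_sym induced_adj_irrefl.

End Induced.

(* A chord is an edge between two vertices that are not consecutive on c. *)
Definition is_chord (G : sgraph) (c : seq G) (x y : G) : bool :=
  [&& x \in c, y \in c, adj x y, y != next c x & x != next c y].

Definition chordal (G : sgraph) : Prop :=
  forall c : seq G, ucycle (@adj G) c -> 4 <= size c ->
    exists x y : G, is_chord c x y.

(* Vacuously true of the vertex of a one-vertex graph. *)
Definition universal (G : sgraph) (x : G) : bool :=
  [forall y : G, (y != x) ==> adj x y].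

Definition chordal_star (G : sgraph) : Prop :=
  chordal G /\ forall x : G, ~~ universal x.

(* The graph with no vertex is not disconnected. *)
Definition disconnected (G : sgraph) : bool :=
  [exists x : G, exists y : G, ~~ connect (@adj G) x y].

(* Every separating set W satisfies #|W| <= #|G| - 2, so the default value
   #|G|.-1 is taken only if there is none, i.e. only if G is complete. *)
Definition kappa (G : sgraph) : nat :=
  \big[minn/#|G|.-1]_(W : {set G} | disconnected (induced (~: W))) #|W|.

Definition vertex_cover (G : sgraph) (C : {set G}) : bool :=
  [forall x : G, forall y : G, adj x y ==> (x \in C) || (y \in C)].

Definition tau_max (G : sgraph) : nat :=
  \max_(C : {set G} | minset (@vertex_cover G) C) #|C|.

(* Main.v *)
(** Minimal vertex covers of the complement are the complements of the maximal
    cliques of G, so the first inequality says that kappa(G) < |K| for every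
    maximal clique K.  If v outside K has as many neighbours in K as possible,
    these neighbours separate v from the rest of K: on a path avoiding them, the
    first vertex z adjacent to some x in the rest of K would, by chordality, be
    adjacent to x and to all K-neighbours of v.

    For the second inequality, the complement of G has no isolated vertex, so
    its vertices split into g stars with at least two vertices each.  If the
    largest star has m vertices, then n <= g m, and a maximal clique of G
    through its centre omits at least (m - 1) + (g - 1) >= 2 sqrt n - 2 vertices.

    The values of kappa are realised by split graphs: the vertices of a clique L
    are mapped onto an independent set C, and l is joined to every c except its
    image; the connectivity is |L| minus the size of the largest fibre. *)

Require Import Defs.
From mathcomp Require Import all_boot all_order all_algebra reals zify.
Set Implicit Arguments.
Unset Strict Implicit.
Unset Printing Implicit Defensive.

(** * Cyclic successors in sequences without repetition *)

Section Next.
Variable T : eqType.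
Implicit Types (x y : T) (s : seq T).

Lemma next_cat_cons2 s1 x y s2 :
  uniq (s1 ++ [:: x, y & s2]) -> next (s1 ++ [:: x, y & s2]) x = y.
Proof.
move=> U; rewrite next_nth mem_cat mem_head orbT.
have xs1 : x \notin s1.
  by move: U; rewrite cat_uniq => /and3P[_ /hasPn/(_ x) H _]; apply/H/mem_head.
case: s1 xs1 {U} => [|z s1] //=; rewrite ?eqxx // inE negb_or => /andP[zx xs1].
rewrite eq_sym (negPf zx) index_cat (negPf xs1) /= eqxx addn0.
by rewrite nth_cat ltnNge leqnSn subSnn.
Qed.

(** The index of the last element is out of range for [s], so the [nth] behind [next] returns its
    default, the head. *)
Lemma next_last x s : uniq (x :: s) -> next (x :: s) (last x s) = x.
Proof. by move=> U; rewrite next_nth mem_last index_last // nth_default. Qed.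

Lemma split_two s x y : x \in s -> y \in s -> x != y ->
  exists s1 s2 s3, s = s1 ++ x :: s2 ++ y :: s3 \/ s = s1 ++ y :: s2 ++ x :: s3.
Proof.
move=> xs; case/splitPr: xs => s1 s2; rewrite mem_cat inE => /or3P[].
- by case/splitPr=> s3 s4 _; exists s3, s4, s2; right; rewrite -catA.
- by rewrite eq_sym => ->.
- by case/splitPr=> s3 s4 _; exists s1, s3, s4; left.
Qed.

End Next.

(** * Chords of cycles and common neighbours *)

Section Chordal.
Variable G : sgraph.
Implicit Types (x y u v : G) (c s : seq G) (K W : {set G}).

Lemma is_chord_sym c x y : is_chord c x y = is_chord c y x.
Proof.
rewrite /is_chord adj_sym; case: (x \in c); case: (y \in c) => //=.
by case: (adj y x) => //=; rewrite andbC.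
Qed.

(** The two arcs between the ends of the chord, [s2] and [s3 ++ s1], are nonempty because neither
    end is the cyclic successor of the other. *)
Lemma chord_split c : uniq c -> (exists x y, is_chord c x y) ->
  exists u v s1 s2 s3, [/\ c = s1 ++ u :: s2 ++ v :: s3, adj u v,
     s2 != [::] & (s1 != [::]) || (s3 != [::])].
Proof.
move=> Uc [x [y xy]]; have /and5P[xc yc axy _ _] := xy.
have nxy : x != y by apply: contraTneq axy => ->; rewrite adj_irrefl.
have [s1 [s2 [s3 E]]] := split_two xc yc nxy.
wlog{E} E : x y xy {xc yc nxy} axy / c = s1 ++ x :: s2 ++ y :: s3.
  case: E => E H; first exact: (H x y).
  by apply: (H y x); rewrite ?(is_chord_sym c y x) ?(adj_sym y).
exists x, y, s1, s2, s3; move/and5P: xy => [_ _ _ n1 n2]; split=> //.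
  apply: contraNneq n1 => s20; rewrite E s20 next_cat_cons2 //.
  by rewrite -[X in uniq X]/(s1 ++ x :: [::] ++ _) -s20 -E.
case: s1 s3 E => [|? ?] [|? ?] //= E; case/negP: n2.
by move: Uc; rewrite E -cat_rcons cats0 => /next_last; rewrite last_rcons => ->.
Qed.

(* A shortest cycle through the edge [x y] with remaining vertices in [s]
   has no chord, so it is a triangle. *)
Lemma chordal_common_neighbor x y s : chordal G ->
  cycle (@adj G) [:: y, x & s] -> s != [::] -> x \notin s -> y \notin s ->
  exists2 z, z \in s & adj x z && adj y z.
Proof.
move=> chG; have [m] := ubnP (size s); elim: m s => // m IH s lem.
move=> cyc s0 xs ys; move: cyc; rewrite /= rcons_path => /and3P[ayx].
have ls : last x s \in s by case: s s0 {lem xs ys} => //= a s _; exact: mem_last.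
move: ls => /[swap] /shortenP[s' p' U' sub] ls aly.
have {}sub : {subset s' <= s} by move=> z; apply: sub.
have ys' : y \notin s' by apply: contra ys => /sub.
have les : size s' <= size s by apply: uniq_leq_size; [case/andP: U'|].
suff [z zs' az] : exists2 z, z \in s' & adj x z && adj y z.
  by exists z => //; exact: sub.
have {ls} s'0 : s' != [::] by case: s' ls xs {p' U' aly sub ys' les} => //= ->.
have {}lem : size s' <= m by apply: leq_trans les _.
have {xs s0 sub ys les} cyc : cycle (@adj G) [:: y, x & s'].
  by rewrite /= rcons_path ayx p'.
have U : uniq [:: y, x & s'].
  rewrite cons_uniq U' inE negb_or ys' !andbT.
  by apply: contraTneq ayx => ->; rewrite adj_irrefl.
have xs' : x \notin s' by case/andP: U'.
have [sz|sz] := leqP (size s') 1.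
  case: s' s'0 sz cyc {lem p' U' aly ys' U xs'} => [|a [|//]] //= _ _.
  case/and4P=> _ xa ay _.
  by exists a; rewrite ?mem_head // xa adj_sym.
have [] := chord_split U; first by apply: chG; rewrite /= ?ltnS //; apply/andP.
have shorter t : size t < size s' -> {subset t <= s'} -> t != [::] ->
    cycle (@adj G) [:: y, x & t] -> exists2 z, z \in s' & adj x z && adj y z.
  move=> szt sub tn ct.
  have [|||||z zs az] := IH t => //.
  - exact: leq_trans szt lem.
  - by apply: contra xs' => /sub.
  - by apply: contra ys' => /sub.
  - by exists z => //; apply: sub.
(* The chord starts at [y], at [x], or after both. It bypasses [s3], [s2] or [s2] respectively, so a
   shorter cycle through the edge from [x] to [y] remains. *)
move=> u [v [[|a [|b s1]] [s2 [s3 [E auv n2 n13]]]]].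
- case: s2 E n2 => [|a s2] //= [? ? E] _; subst a u.
  apply: (shorter (rcons s2 v)).
  + by rewrite E size_rcons size_cat; case: s3 n13 {E} => //= *;
    rewrite !addnS !ltnS leq_addr.
  + move=> z; rewrite E mem_rcons mem_cat !inE => /orP[]->; rewrite ?orbT //.
  + by case: s2 {E}.
  + move: cyc; rewrite E /= -cat_rcons rcons_cat cat_path => /and3P[-> ? _].
    by rewrite /= rcons_path last_rcons (adj_sym v) auv andbT.
- case: s2 E n2 => [|b s2] //= [? ? E] _; subst a u.
  apply: (shorter (v :: s3)) => //.
  + by rewrite E /= size_cat ltnS leq_addl.
  + by move=> z zs; rewrite E inE mem_cat zs !orbT.
  + move: cyc; rewrite E /= rcons_cat cat_path auv ayx /=.
    by case/and4P.
- case: E => ? ? E; subst a b.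
  apply: (shorter (s1 ++ [:: u, v & s3])).
  + by rewrite E !size_cat ltn_add2l /= size_cat; case: s2 n2 {E} => //= *;
    rewrite !ltnS leq_addl.
  + move=> z; rewrite E !(mem_cat, inE) => /or4P[]->; rewrite ?orbT //.
  + by case: s1 {E n13}.
  + move: cyc; rewrite E /= !(rcons_cat, rcons_cons, cat_path) /=
      !(rcons_cat, cat_path) /=.
    by rewrite auv => /and5P[-> -> -> _ /andP[_ ->]].
Qed.

(** * Maximal cliques and separating sets *)

Definition clique K := [forall x in K, forall y in K, (x != y) ==> adj x y].

Lemma cliqueP K :
  reflect {in K &, forall x y, x != y -> adj x y} (clique K).
Proof.
apply: (iffP forall_inP) => [H x y xK yK xy|H x xK].
  by have /forall_inP/(_ y yK)/implyP := H x xK; apply.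
by apply/forall_inP => y yK; apply/implyP; apply: H.
Qed.

Lemma maximal_cliqueP K : maxset clique K ->
  clique K /\ forall x, x \notin K -> exists2 y, y \in K & ~~ adj x y.
Proof.
case/maxsetP=> cK mK; split=> // x xK.
apply/exists_inP; rewrite -negb_forall_in; apply: contra xK => /forall_inP H.
suff <- : x |: K = K by rewrite setU11.
apply: mK; last exact: subsetUr.
apply/cliqueP => a b /setU1P[->|aK] /setU1P[->|bK]; rewrite ?eqxx //.
- by rewrite H.
- by rewrite adj_sym H.
- by move/cliqueP: cK; apply.
Qed.

Lemma kappa_le_separator W : disconnected (induced (~: W)) -> kappa G <= #|W|.
Proof.
by move=> dW; exact: (@Order.TotalTheory.bigmin_le_cond _ nat _ #|G|.-1 W
  (fun W => disconnected (induced (~: W))) (fun W : {set G} => #|W|) dW).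
Qed.

Lemma kappa_lt_card : 0 < #|G| -> kappa G < #|G|.
Proof.
move=> n0; rewrite -[X in _ < X](prednK n0) ltnS /kappa.
by elim/big_rec: _ => // W m _ le_m; rewrite geq_min le_m orbT.
Qed.

(** The path is cut at its first vertex with a neighbour in [K :\: W]. This happens before it enters
    [K], because the vertex where it enters avoids [W]. *)
Lemma path_to_clique K W v p : path (@adj G) v p -> v \notin K ->
    last v p \in K -> {in p, forall u, u \notin W} ->
  exists q, [/\ path (@adj G) v q, {in v :: q, forall u, u \notin K},
    exists2 x, x \in K :\: W & adj (last v q) x &
    {in belast v q, forall u, {in K :\: W, forall x, ~~ adj u x}}].
Proof.
elim: p v => [|u p IH] v /=; first by move=> _ /negPf->.
case/andP=> avu pu vK lK pW.
case: (boolP [exists x in K :\: W, adj v x]) => [/exists_inP ex|].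
  by exists [::]; split=> // w; rewrite inE => /eqP->.
rewrite negb_exists_in => /forall_inP nv.
have uK : u \notin K.
  by apply: contraL avu => uK; rewrite nv // inE uK pW ?mem_head.
have [|q [pq qK lq bq]] := IH u pu uK lK.
  by move=> w wp; rewrite pW // inE wp orbT.
exists (u :: q); split=> //=; first by rewrite avu.
- by move=> w; rewrite inE => /orP[/eqP->|/qK].
- by move=> w; rewrite inE => /orP[/eqP->|/bq].
Qed.

(* A vertex [v] outside [K] with as many neighbours in [K] as possible is
   separated from the rest of [K] by these neighbours. *)
Lemma kappa_lt_maximal_clique K : chordal G -> maxset clique K ->
  K != [set: G] -> kappa G < #|K|.
Proof.
move=> chG /maximal_cliqueP[/cliqueP cK mK] KT.
have [v0 v0K] : exists v0, v0 \notin K.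
  by apply/existsP; rewrite -negb_forall; apply: contra KT => /forallP H;
     apply/eqP/setP=> z; rewrite inE H.
pose nb v := [set y in K | adj v y].
case: (@arg_maxnP _ v0 (fun v => v \notin K) (fun v => #|nb v|) v0K).
move=> v vK vmax; set W := nb v.
have [x0 x0K x0v] := mK v vK.
have x0W : x0 \notin W by rewrite !inE x0K.
have WK : W \subset K by apply/subsetP=> y; rewrite inE => /andP[].
apply: (@leq_ltn_trans #|W|); last first.
  by apply: proper_card; apply/properP; split=> //; exists x0.
apply: kappa_le_separator.
have vW : v \in ~: W by rewrite !inE negb_and vK.
have x0W' : x0 \in ~: W by rewrite inE.
apply/existsP; exists (exist _ v vW); apply/existsP; exists (exist _ x0 x0W').
apply/negP=> /connectP[p pp lp].
have {}pp : path (@adj G) v (map val p).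
  by rewrite -[v]/(val (exist _ v vW)) path_map.
have {}lp : last v (map val p) \in K.
  by rewrite -[v]/(val (exist (fun x => x \in ~: W) v vW)) last_map -lp.
have pW : {in map val p, forall u, u \notin W}.
  by move=> u /mapP[w _ ->]; have := valP w; rewrite inE.
have [q [pq qK [x]]] := path_to_clique pp vK lp pW.
rewrite inE => /andP[xW xK] axl bq; set z := last v q in axl.
have := vmax z (qK _ (mem_last _ _)); rewrite /= leqNgt => /negP; apply.
apply: proper_card; apply/properP; split; last first.
  by exists x => //; rewrite inE xK.
apply/subsetP=> y yW; have /[!inE] /andP[yK avy] := yW; rewrite yK.
have yx : y != x by apply: contraNneq xW => <-.
(* On the cycle [x, y, v, ..., z] only [z] can be the common neighbour of [x] and [y], since no
   earlier vertex of [v :: q] is adjacent to [x]. *)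
have [||||w wq] := @chordal_common_neighbor y x (v :: q) chG.
- by rewrite /= rcons_path adj_sym cK // adj_sym avy pq.
- by [].
- by apply: contraL yK => /qK.
- by apply: contraL xK => /qK.
case/andP=> ayw axw; suff <- : w = z by rewrite adj_sym.
move: wq; rewrite lastI mem_rcons inE => /orP[/eqP//|/bq/(_ x)].
by rewrite inE xK xW adj_sym axw => /(_ isT).
Qed.

End Chordal.

(** * Partitions into stars *)

Section Stars.
Variables (T : finType) (e : rel T).
Hypotheses (e_sym : symmetric e) (e_irr : irreflexive e).
Hypothesis e_ex : forall x, exists y, e x y.

(* A partition of the vertices into stars with at least two vertices each:
   [f] maps a vertex to the centre of its star.  It is obtained by minimising
   the number of one-vertex stars. *)
Lemma star_partition : exists f : T -> T,
  [/\ forall x, f (f x) = f x, forall x, f x != x -> e x (f x)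
    & forall x, exists2 y, y != x & f y = f x].
Proof.
pose P (f : {ffun T -> T}) :=
  [forall x, (f (f x) == f x) && ((f x != x) ==> e x (f x))].
pose S (f : {ffun T -> T}) := [set x | [forall y, (f y == f x) ==> (y == x)]].
have SP (f : {ffun T -> T}) x :
    reflect (forall y, f y = f x -> y = x) (x \in S f).
  rewrite inE; apply: (iffP forallP) => [H y /eqP fyx|H y].
    by have /implyP/(_ fyx)/eqP := H y.
  by apply/implyP=> /eqP/H->.
have P0 : P [ffun x => x] by apply/forallP=> x; rewrite !ffunE !eqxx.
case: (@arg_minnP _ _ P (fun f => #|S f|) P0) => f /forallP fP fmin.
have ff x : f (f x) = f x by have /andP[/eqP] := fP x.
have fe x : f x != x -> e x (f x) by have /andP[_ /implyP] := fP x.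
exists f; split=> // v.
suff /exists_inP[y yv /eqP fyv] : [exists (y | y != v), f y == f v] by exists y.
apply: contraT; rewrite negb_exists_in => /forall_inP vS0.
have vS y : f y = f v -> y = v.
  by move=> fyv; apply/eqP; apply: contraT => /vS0; rewrite fyv eqxx.
have vSf : v \in S f by apply/SP.
have fv : f v = v by apply: vS.
have [w evw] := e_ex v.
have wv : w != v by apply: contraTneq evw => ->; rewrite e_irr.
have fxv x : x != v -> f x != v.
  by apply: contraNneq => fx; apply/eqP/vS; rewrite fx fv.
suff [f' Pf' sub] : exists2 f', P f' & {subset S f' <= S f :\ v}.
  have := fmin f' Pf'; rewrite leqNgt => /negP[].
  apply: leq_ltn_trans (_ : #|S f :\ v| < _).
    by apply: subset_leq_card; apply/subsetP.
  by rewrite (cardsD1 v (S f)) vSf.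
(* If [w] is a leaf beside another leaf [w'], it leaves its star and becomes the centre of a new
   star [{v, w}]. *)
case: (boolP [exists w', [&& f w != w, w' != w, w' != f w & f w' == f w]]).
  case/existsP=> w' /and4P[fw w'w w'fw /eqP fw'].
  exists [ffun x => if (x == v) || (x == w) then w else f x].
    apply/forallP=> x; rewrite !ffunE.
    have [->|xv] := eqVneq x v; first by rewrite /= eqxx orbT eqxx evw implybT.
    have [->|xw] := eqVneq x w; first by rewrite /= eqxx orbT /= !eqxx.
    rewrite /= (negPf (fxv x xv)) ff /=.
    have [fx|_] := eqVneq (f x) w; last by rewrite eqxx; apply/implyP/fe.
    by case/eqP: fw; rewrite -fx ff.
  move=> x /SP H.
  have xw : x != w.
    by apply: contraNneq wv => xw; rewrite (H v) ?xw // !ffunE !eqxx orbT.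
  have xv : x != v.
    by apply: contraNneq wv => xv; rewrite (H w) ?xv // !ffunE !eqxx orbT.
  rewrite in_setD1 xv /=; apply/SP=> y fyx.
  have [yv|yv] := eqVneq y v; first by move: (fxv x xv); rewrite -fyx yv fv eqxx.
  have [yw|yw] := eqVneq y w; last first.
    by apply: H; rewrite !ffunE (negPf yv) (negPf yw) (negPf xv) (negPf xw).
  have w'v : w' != v.
    by apply: contraNneq wv => w'v; apply/eqP/vS; rewrite -fw' w'v.
  have w'x : w' = x.
    apply: H; rewrite !ffunE (negPf w'v) (negPf w'w) (negPf xv) (negPf xw).
    by rewrite fw' -fyx yw.
  case/eqP: w'fw; rewrite w'x -yw fyx; apply/esym/H.
  rewrite !ffunE (negPf (fxv x xv)) -fyx yw (negPf fw) (negPf xv) (negPf xw).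
  by rewrite ff -yw.
(* Otherwise [w] is a centre or its star is [{w, f w}]; recentred at [w], this star takes in [v]. *)
rewrite negb_exists => /forallP star_w.
exists [ffun x => if (x == v) || (f x == f w) then w else f x].
  apply/forallP=> x; rewrite !ffunE.
  have [->|xv] := eqVneq x v; first by rewrite /= eqxx orbT eqxx evw implybT.
  case: (eqVneq (f x) (f w)) => /= [fxw|fxw]; last first.
    by rewrite (negPf (fxv x xv)) ff (negPf fxw) /= eqxx; apply/implyP/fe.
  rewrite eqxx orbT eqxx; apply/implyP=> xw.
  have := star_w x; rewrite fxw eqxx andbT.
  have [fw|fw] := eqVneq (f w) w.
    by move=> _; move: (fe x); rewrite fxw fw => /(_ xw).
  by rewrite (eq_sym x w) xw /= negbK => /eqP->; rewrite e_sym fe.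
move=> x /SP H.
have xv : x != v.
  by apply: contraNneq wv => xv; rewrite (H w) ?xv // !ffunE !eqxx orbT.
have fxw : f x != f w.
  apply: contraNneq wv => fxw.
  have xw : w = x by apply: H; rewrite !ffunE fxw eqxx !orbT.
  by rewrite xw -(H v) // !ffunE eqxx fxw eqxx orbT.
rewrite in_setD1 xv /=; apply/SP=> y fyx.
have [yv|yv] := eqVneq y v; first by move: (fxv x xv); rewrite -fyx yv fv eqxx.
by apply: H; rewrite !ffunE (negPf yv) (negPf xv) fyx (negPf fxw).
Qed.

End Stars.

(** * Counting the vertices outside a maximal clique *)

Lemma card_fibers (T : finType) (f : T -> T) (A : {set T}) :
  (forall x, f (f x) = f x) ->
  #|A| = \sum_(u | f u == u) #|A :&: [set x | f x == u]|.
Proof.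
move=> ff; rewrite -sum1_card (partition_big f (fun u => f u == u)) => [|x _].
  by apply: eq_bigr => u _; rewrite -sum1_card; apply: eq_bigl => x; rewrite !inE.
by rewrite ff.
Qed.

(* A maximal clique through the centre [v] of a largest star in a partition of
   the complement into stars omits all leaves of [v] and a vertex of every
   other star. *)
Lemma small_maximal_clique (G : sgraph) : 0 < #|G| ->
  (forall x : G, ~~ universal x) ->
  exists2 K : {set G}, maxset (@clique G) K & 4 * #|G| <= (#|~: K| + 2) ^ 2.
Proof.
case/card_gt0P=> z _ nU.
have [|f [ff fe fS]] := star_partition (@compl_adj_sym G) (@compl_adj_irrefl G).
  move=> x; have := nU x; rewrite negb_forall => /existsP[y].
  by rewrite negb_imply => yx; exists y; rewrite /compl_adj /= eq_sym.
pose fib u := [set x | f x == u].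
have fz : f (f z) == f z by rewrite ff.
case: (@arg_maxnP _ _ (fun u => f u == u) (fun u => #|fib u|) fz).
move=> v /eqP fv vmax.
have [|K mK vK] := @maxset_exists _ (@clique G) [set v].
  by apply/cliqueP=> x y /set1P-> /set1P->; rewrite eqxx.
exists K => //; rewrite sub1set in vK.
have [/cliqueP cK _] := maximal_cliqueP mK.
have leaf u : u \in K -> f u = u -> forall w, f w = u -> w != u -> w \notin K.
  move=> uK fu w fw wu; apply/negP=> wK.
  by have := fe w; rewrite fw eq_sym wu => /(_ isT)/andP[_ /negP[]]; apply: cK.
pose g := #|[pred u | f u == u]|.
have n_le : #|G| <= g * #|fib v|.
  rewrite -cardsT (card_fibers _ ff) -sum_nat_const.
  by apply: leq_sum => u fu; rewrite setTI; apply: vmax.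
have K_ge : g + #|fib v| <= #|~: K| + 2.
  rewrite (card_fibers (~: K) ff) (bigD1 v) /=; last by rewrite fv.
  have -> : g = (\sum_(u | (f u == u) && (u != v)) 1).+1.
    by rewrite /g -sum1_card (bigD1 v) //= inE fv.
  have -> : #|fib v| = #|fib v :\ v|.+1 by rewrite (cardsD1 v) inE fv eqxx.
  rewrite addSn addnS addn2 !ltnS addnC; apply: leq_add.
    apply: subset_leq_card; apply/subsetP=> x; rewrite !inE => /andP[xv /eqP fx].
    by rewrite fx eqxx andbT; apply: leaf fx xv.
  (* Each other star contributes its centre or, if the centre lies in [K], any of its leaves. *)
  apply: leq_sum => u /andP[/eqP fu _]; apply/card_gt0P.
  have [uK|uK] := boolP (u \in K); last by exists u; rewrite !inE uK fu eqxx.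
  have [w wu fw] := fS u; exists w.
  by rewrite !inE fw fu eqxx andbT; apply: leaf wu; rewrite // fw.
(* AM-GM: [4 * g * m <= (g + m) ^ 2] with [m = #|fib v|]. *)
apply: leq_trans (leq_mul (leqnn 4) n_le) _.
by apply: leq_trans (nat_AGM2 _ _) _; rewrite leq_exp2r.
Qed.

(** * The two upper bounds in natural numbers *)

Lemma clique_neq_setT (G : sgraph) (K : {set G}) : 0 < #|G| ->
  (forall x : G, ~~ universal x) -> clique K -> K != [set: G].
Proof.
case/card_gt0P=> x _ nU /cliqueP cK; apply: contra (nU x) => /eqP KT.
by apply/forallP=> y; apply/implyP=> yx; apply: cK; rewrite ?KT ?inE // eq_sym.
Qed.

(** A set covers the complement iff the vertices outside it are pairwise adjacent in [G], and taking
    complements reverses inclusion. *)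
Lemma minimal_cover_compl_clique (G : sgraph) (C : {set G}) :
  minset (@vertex_cover (complement G)) C -> maxset (@clique G) (~: C).
Proof.
have coverE (D : {set G}) : @vertex_cover (complement G) D = clique (~: D).
  apply/idP/cliqueP => [/forallP H x y|H].
    rewrite !inE => xD yD xy; have /forallP/(_ y)/implyP := H x.
    rewrite /= /compl_adj /= xy (negPf xD) (negPf yD) /=.
    by case: (adj x y) => // /(_ isT).
  apply/forallP=> x; apply/forallP=> y; apply/implyP=> /andP[xy].
  by apply: contraNT; rewrite negb_or => /andP[xD yD]; apply: H; rewrite ?inE.
case/minsetP=> cC mC; apply/maxsetP; rewrite -coverE; split=> // B cB sub.
rewrite -[B]setCK (mC (~: B)) ?coverE ?setCK //.
by rewrite -[C]setCK setCS.
Qed.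

Lemma kappa_tau_max (G : sgraph) : 0 < #|G| -> chordal_star G ->
  kappa G + tau_max (complement G) < #|G|.
Proof.
move=> n0 [chG nU].
have kn := kappa_lt_card n0.
suff : tau_max (complement G) <= #|G|.-1 - kappa G.
  by move=> le_t; lia.
apply/bigmax_leqP=> C /minimal_cover_compl_clique mC.
have [cC _] := maximal_cliqueP mC.
have := kappa_lt_maximal_clique chG mC (clique_neq_setT n0 nU cC).
rewrite -(cardsC (C : {set G})) => kC.
rewrite leq_subRL; last by rewrite -ltnS prednK ?cardsC //.
rewrite -ltnS prednK; last by rewrite cardsC.
by rewrite addnC ltn_add2l.
Qed.

(** The second bound, freed of square roots: [kappa G < #|K|] means
    [#|~: K| + 1 <= #|G| - kappa G]. *)
Lemma kappa_sqr_bound (G : sgraph) : 0 < #|G| -> chordal_star G ->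
  4 * #|G| <= (#|G| - kappa G + 1) ^ 2.
Proof.
move=> n0 [chG nU]; have [K mK leK] := small_maximal_clique n0 nU.
apply: (leq_trans leK); rewrite leq_exp2r // addn2 addn1 ltnS.
have [cK _] := maximal_cliqueP mK.
have kK := kappa_lt_maximal_clique chG mK (clique_neq_setT n0 nU cK).
by rewrite ltn_subRL -(cardsC K) ltn_add2r.
Qed.

(** * Split graphs and their connectivity *)

Section SplitGraph.
Variables (C L : finType) (f : L -> C).

Definition split_adj : rel (C + L) := fun a b =>
  match a, b with
  | inl _, inl _ => false
  | inl c, inr l | inr l, inl c => f l != c
  | inr l, inr l' => l != l'
  end.

Lemma split_adj_sym : symmetric split_adj.
Proof. by case=> [c|l] [c'|l'] //=; rewrite eq_sym. Qed.

Lemma split_adj_irrefl : irreflexive split_adj.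
Proof. by case=> [c|l] //=; rewrite eqxx. Qed.

Definition split_graph : sgraph := SGraph split_adj_sym split_adj_irrefl.

Let isL (x : split_graph) : bool := if x is inr _ then true else false.

Lemma split_adj_L x y : isL x -> isL y -> x != y -> adj x y.
Proof. by case: x y => [?|l] [?|l']. Qed.

(** Consecutive vertices never both lie in [C], so a cycle of length at least 4 has two
    nonconsecutive vertices in the clique [L]. *)
Lemma split_graph_chordal : chordal split_graph.
Proof.
have cL (x y : split_graph) : adj x y -> ~~ isL x -> isL y.
  by case: x y => [?|?] [?|?].
case=> [|x [|y [|z [|w s]]]] //= /andP[cyc U] _.
set c := [:: x, y, z, w & s] in cyc U *.
have ne (u v : split_graph) s1 s2 s3 :
    c = s1 ++ u :: s2 ++ v :: s3 -> u != v.
  move=> E; move: U; rewrite E cat_uniq /= mem_cat inE => /and4P[_ _ + _].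
  by rewrite !negb_or => /and3P[].
have nx s1 (u v : split_graph) s2 : c = s1 ++ [:: u, v & s2] -> next c u = v.
  by move=> E; rewrite E next_cat_cons2 // -E.
have xy : x != y by apply: (ne x y [::] [::] [:: z, w & s]).
have xz : x != z by apply: (ne x z [::] [:: y] [:: w & s]).
have yw : y != w by apply: (ne y w [:: x] [:: z] s).
have zl : z != last w s.
  by apply: (ne z _ [:: x; y] (belast w s) [::]); rewrite cats1 -lastI.
have yl : y != last w s.
  apply: (ne y _ [:: x] (z :: belast w s) [::]).
  by rewrite cats1 /= -lastI.
have nextx : next c x = y by apply: (nx [::]).
have nexty : next c y = z by apply: (nx [:: x]).
have nextz : next c z = w by apply: (nx [:: x; y]).
have nextl : next c (last w s) = x by rewrite -[RHS](next_last U).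
move: cyc; rewrite /= rcons_path => /and5P[axy ayz azw _ alx].
have [Lx|Lx] := boolP (isL x); last first.
  have Ly := cL _ _ axy Lx.
  have Ll : isL (last w s) by apply: cL Lx; rewrite adj_sym.
  have lc : last w s \in c by exact: (mem_last x [:: y, z, w & s]).
  exists y, (last w s); rewrite /is_chord nexty nextl split_adj_L //.
  by rewrite lc inE mem_head orbT /= [_ == z]eq_sym zl [_ == x]eq_sym xy.
have [Lz|Lz] := boolP (isL z).
  exists x, z; rewrite /is_chord nextx nextz split_adj_L // !inE !eqxx !orbT /=.
  rewrite eq_sym (ne y z [:: x] [::] (w :: s)) //=.
  exact: (ne x w [::] [:: y; z] s).
have Lw := cL _ _ azw Lz.
have Ly : isL y by apply: cL Lz; rewrite adj_sym.
have ynw : y != next c w.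
  have [s0|[a [s' sE]]] : s = [::] \/ exists a s', s = a :: s'.
  - by case: (s) => [|a s']; [left | right; exists a, s'].
  - by move: nextl; rewrite s0 -[last w _]/w => ->; rewrite eq_sym.
  rewrite (nx [:: x; y; z] w a s') /c ?sE //.
  by apply: (ne y a [:: x] [:: z; w] s'); rewrite /c sE.
exists y, w; rewrite /is_chord nexty ynw split_adj_L // !inE !eqxx !orbT /=.
by rewrite andbT eq_sym (ne z w [:: x; y] [::] s).
Qed.

Hypothesis f_surj : forall c, exists l, f l = c.

Lemma split_graph_chordal_star : chordal_star split_graph.
Proof.
split=> [|[c|l]]; first exact: split_graph_chordal.
- have [l fl] := f_surj c; apply/negP=> /forallP/(_ (inr l)).
  by rewrite /= fl eqxx.
- by apply/negP=> /forallP/(_ (inl (f l))); rewrite /= eqxx.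
Qed.

Variable M : nat.
Hypothesis fiber_le : forall c, #|[set l | f l == c]| <= M.
Hypothesis fiber_eq : exists c, #|[set l | f l == c]| = M.

(** A vertex of [C] misses at most [M] vertices of [L]. If [#|W| + M < #|L|], it keeps a neighbour
    in [L], and what is left of [L] is a clique. *)
Lemma split_graph_disconnected (W : {set split_graph}) :
  disconnected (induced (~: W)) -> #|L| <= #|W| + M.
Proof.
apply: contraTT; rewrite -ltnNge => ltL.
pose WL : {set L} := inr @^-1: W.
have leW : #|WL| <= #|W|.
  rewrite -(card_imset (mem WL) (@inr_inj C L)); apply: subset_leq_card.
  by apply/subsetP=> _ /imsetP[l lW ->]; rewrite inE in lW.
have nb c : exists2 l, l \notin WL & f l != c.
  have : ~: (WL :|: [set l | f l == c]) != set0.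
    rewrite -card_gt0 -(ltn_add2l #|WL :|: [set l | f l == c]|) cardsC addn0.
    apply: leq_ltn_trans ltL; apply: leq_trans (leq_card_setU _ _) _.
    exact: leq_add.
  case/set0Pn=> l; rewrite !inE negb_or => /andP[lW flc].
  by exists l; rewrite ?inE.
have [c0 _] := fiber_eq; have [l0 l0W _] := nb c0.
have vW (l : L) : l \notin WL -> (inr l : split_graph) \in ~: W by rewrite !inE.
pose v0 : induced (~: W) := exist _ (inr l0 : split_graph) (vW _ l0W).
have toL (l : L) (lW : l \notin WL) :
    connect (@adj (induced (~: W))) (exist _ (inr l : split_graph) (vW _ lW)) v0.
  have [e|ne] := eqVneq l l0; last exact: connect1.
  rewrite (_ : exist _ _ _ = v0) //; apply: val_inj; by rewrite /= e.
have to0 x : connect (@adj (induced (~: W))) x v0.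
  case: x => [[c|l] xW].
    have [l lW flc] := nb c; apply: connect_trans (toL l lW).
    exact: connect1.
  have lW : l \notin WL by move: (xW); rewrite !inE.
  rewrite (_ : exist _ _ _ = exist _ (inr l : split_graph) (vW _ lW)) //.
  exact: val_inj.
apply/existsPn=> x; apply/existsPn=> y; rewrite negbK.
apply: connect_trans (to0 x) _.
by rewrite (sym_connect_sym (@adj_sym (induced (~: W)))).
Qed.

Lemma kappa_split_graph : kappa split_graph + M = #|L|.
Proof.
have [c cM] := fiber_eq; have [l flc] := f_surj c.
apply/eqP; rewrite eqn_leq; apply/andP; split; last first.
  rewrite /kappa; elim/big_rec: _ => [|W m dW le_m].
    (* The default value [#|C| + #|L| - 1] is at least [#|L|], as [C] is nonempty. *)
    have C0 : 0 < #|C| by apply/card_gt0P; exists c.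
    have M0 : 0 < M by rewrite -cM; apply/card_gt0P; exists l; rewrite inE flc.
    rewrite /= card_sum -(prednK C0) addSn /= (leq_trans (leq_addl #|C|.-1 _)) //.
    exact: leq_addr.
  have [_|_] := leqP #|W| m => //; exact: split_graph_disconnected.
(* Deleting all neighbours of [c] separates it from its fibre, which contains [l]. *)
pose W : {set split_graph} := inr @: ~: [set l' | f l' == c].
have dW : disconnected (induced (~: W)).
  have cW : (inl c : split_graph) \in ~: W.
    by rewrite inE; apply/imsetP=> -[].
  have lW : (inr l : split_graph) \in ~: W.
    by rewrite inE mem_imset ?inE ?flc ?eqxx //; exact: inr_inj.
  apply/existsP; exists (exist _ (inl c : split_graph) cW).
  apply/existsP; exists (exist _ (inr l : split_graph) lW).
  apply/negP=> /connectP[[|[x xW] p]] //= /andP[]; rewrite /induced_adj /=.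
  move=> /[swap] _ /[swap] _; move: xW; case: x => //= l' + fl'.
  by rewrite inE mem_imset ?inE ?fl' //; exact: inr_inj.
apply: leq_trans (leq_add (kappa_le_separator dW) (leqnn M)) _.
by rewrite card_imset ?(addnC _ M) -?cM ?cardsC //; exact: inr_inj.
Qed.

End SplitGraph.

(** * Realising every admissible connectivity *)

(** ['I_M] is the fibre over [ord0], and ['I_r] is dealt out cyclically to [g] further points:
    [g <= r] makes [f] surjective, and [r <= g * M] keeps these fibres within [M]. *)
Lemma exists_chordal_star g M r : 0 < M -> g <= r <= g * M ->
  exists G : sgraph, [/\ #|G| = g + M + r + 1, chordal_star G & kappa G = r].
Proof.
move=> M0 /andP[gr rgM].
pose f (l : 'I_M + 'I_r) : 'I_g.+1 :=
  if l is inr j then inord (j %% g).+1 else ord0.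
have g0 : 'I_r -> 0 < g.
  by case=> j jr; move: (leq_trans jr rgM); case: (g).
have fE (j : 'I_r) : f (inr j) = (j %% g).+1 :> nat.
  by rewrite inordK // ltnS ltn_pmod // g0.
have fib0 : #|[set l | f l == ord0]| = M.
  transitivity #|[set @inl 'I_M 'I_r i | i in 'I_M]|; last first.
    by rewrite card_imset ?card_ord //; exact: inl_inj.
  apply: eq_card => -[i|j]; first by rewrite inE eqxx imset_f.
  have /negPf fj0 : f (inr j) != ord0.
    by apply/eqP=> /(congr1 (@nat_of_ord _)); rewrite fE.
  by rewrite inE fj0; apply/esym/negP=> /imsetP[].
have f_surj c : exists l, f l = c.
  case: c => -[|c] cg; first by exists (inl (Ordinal M0)); apply: val_inj.
  have cr : c < r by apply: leq_trans gr.
  exists (inr (Ordinal cr)); apply: ord_inj; rewrite fE /=.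
  by rewrite modn_small.
have f_le c : #|[set l | f l == c]| <= M.
  have [->|c0] := eqVneq c ord0; first by rewrite fib0.
  (* On a fibre [j %% g] is constant, so the quotient [j %/ g], which is below [M], determines
     [j]. *)
  pose h (l : 'I_M + 'I_r) : 'I_M :=
    if l is inr j then insubd (Ordinal M0) (j %/ g) else Ordinal M0.
  rewrite -[X in _ <= X]card_ord -(@card_in_imset _ _ h) ?max_card //.
  have fib_inr l : l \in [set l | f l == c] -> exists2 j, l = inr j & f l = c.
    case: l => [i|j]; rewrite inE => /eqP fc; last by exists j.
    by rewrite -fc eqxx in c0.
  move=> _ _ /fib_inr[j -> jc] /fib_inr[j' -> j'c] hE.
  have lt_h (k : 'I_r) : k %/ g < M.
    by rewrite ltn_divLR ?g0 // mulnC; apply: leq_trans rgM.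
  have := congr1 (fun i : 'I_M => val i) hE.
  rewrite !val_insubd !lt_h => eq_div; congr inr; apply: ord_inj.
  rewrite (divn_eq j g) (divn_eq j' g) eq_div; congr (_ + _).
  by apply: succn_inj; rewrite -!fE jc j'c.
exists (split_graph f); split.
- by rewrite /= !card_sum !card_ord addn1 addSn addnA.
- exact: split_graph_chordal_star.
- have := kappa_split_graph f_surj f_le (ex_intro _ ord0 fib0).
  by rewrite card_sum !card_ord addnC => /addnI.
Qed.

(** With [r = k] in the construction, [g] and [M] must be chosen with sum [t = n - k - 1] and
    [g <= k <= g * M]. *)
Lemma exists_kappa n k : 1 < n -> k < n -> 4 * n <= (n - k + 1) ^ 2 ->
  exists G : sgraph, [/\ #|G| = n, chordal_star G & kappa G = k].
Proof.
move=> n1 kn sq.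
pose t := n - k - 1.
have nE : n = t + k + 1 by rewrite /t; lia.
have {}sq : 4 * k <= t ^ 2.
  by move: sq; rewrite {2}nE (_ : t + k + 1 - k + 1 = t + 2); nia.
have t0 : 0 < t by nia.
have exg : exists g, (k <= g * (t - g)) && (g < t).
  (* At half of [t] the product [g * (t - g)] is the integer part of [t ^ 2 / 4]. *)
  exists t./2; rewrite -divn2; apply/andP; split; last by lia.
  have /orP[/eqP e|/eqP e] : (t == 2 * (t %/ 2)) || (t == 2 * (t %/ 2) + 1).
  - by lia.
  - by move: (t %/ 2) e sq => u -> ; nia.
  - by move: (t %/ 2) e sq => u -> ; nia.
case: (ex_minnP exg) => g /andP[le_k ltg] gmin.
(* Minimality is what bounds [g]: if [k <= g - 1], then [g - 1] would do as well, since its cofactor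
   is positive. *)
have gk : g <= k.
  case: g le_k ltg gmin => // g le_k ltg gmin.
  rewrite ltnNge; apply/negP => kg; have : g.+1 <= g; last by lia.
  apply: gmin; nia.
have [|| G [cG chG kG]] := @exists_chordal_star g (t - g) k.
- by rewrite subn_gt0.
- by rewrite gk.
by exists G; split=> //; rewrite cG; lia.
Qed.

(** * From squares to the ceiling of the real square root *)

Import Order.TTheory GRing.Theory Num.Theory.
Local Open Scope ring_scope.

Lemma ceil_sqrt_le (R : realType) (n t : nat) :
  (Num.ceil (2 * Num.sqrt (n%:R : R) - 2) <= t%:Z) = (4 * n <= (t + 2) ^ 2)%N.
Proof.
rewrite ceil_le_int lerBlDr -[2 in X in _ <= X]/(2%:R) -[t%:~R]/(t%:R) -natrD.
rewrite -(@ler_pXn2r _ 2) ?nnegrE ?mulr_ge0 ?ler0n ?sqrtr_ge0 //.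
by rewrite exprMn sqr_sqrtr ?ler0n // -!natrX -natrM ler_nat.
Qed.

(** This holds as [sqrt n >= 1]; it makes the range of [k] in the existence claim force [k < n]. *)
Lemma ceil_sqrt_ge0 (R : realType) (n : nat) : (0 < n)%N ->
  0 <= Num.ceil (2 * Num.sqrt (n%:R : R) - 2).
Proof.
move=> n0; rewrite -(ler_int R) (le_trans _ (ceil_ge _)) // subr_ge0.
by rewrite ler_peMr // -[X in X <= _]sqrtr1 ler_wsqrtr ?ler1n.
Qed.

(** For [n = 1] the only vertex is vacuously universal, so no graph realises [k = 0], although it
    lies in the range; hence the condition [1 < n]. *)
Theorem theorem1p1 (R : realType) (n : nat) (n_gt0 : (0 < n)%N) :
  (forall G : sgraph, #|G| = n -> chordal_star G ->
     (kappa G)%:Z + (tau_max (complement G))%:Z <= n%:Z - 1 /\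
     0 <= (kappa G)%:Z
       <= (n%:Z - 1) - Num.ceil (2 * Num.sqrt (n%:R : R) - 2)) /\
  ((1 < n)%N ->
   forall k : int,
     0 <= k <= (n%:Z - 1) - Num.ceil (2 * Num.sqrt (n%:R : R) - 2) ->
     exists G : sgraph, [/\ #|G| = n, chordal_star G & (kappa G)%:Z = k]).
Proof.
split=> [G cG chG | n1 k /andP[]].
  rewrite -cG in n_gt0 *; have kn := kappa_lt_card n_gt0.
  split; first by have := kappa_tau_max n_gt0 chG; lia.
  have := kappa_sqr_bound n_gt0 chG.
  have -> : (#|G| - kappa G + 1 = (#|G| - kappa G - 1) + 2)%N by lia.
  by rewrite -(ceil_sqrt_le R); lia.
case: k => // k _ kle; have c0 := ceil_sqrt_ge0 R n_gt0.
have kn : (k < n)%N by lia.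
have le_c : Num.ceil (2 * Num.sqrt (n%:R : R) - 2) <= (n - k - 1)%N%:Z by lia.
move: le_c; rewrite ceil_sqrt_le => sq.
have [|G [cG chG kG]] := exists_kappa n1 kn; last by exists G; split; rewrite ?kG.
by have -> : (n - k + 1 = n - k - 1 + 2)%N by lia.
Qed.
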